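(* Let $\delta$ be the unique zero in $(1/9,1/6)$ of the polynomial $P(d)=1-7d+3d^2+4d^3-2d^4-d^5$. For every real $d$ with $\delta<d<1/4$, the quotient set $F_d/F_d$ contains a nondegenerate interval. Moreover, at $d=1/6$ one has $$[10/7,\,35/24]\subset F_{1/6}/F_{1/6}.$$
   Context: For $0<d\le 1/4$, let $K_d=(1-d)\{\sum_{n=0}^\infty a_n d^n : a_n\in\{0,1\}\}\subset\mathbb{R}$ and $$F_d=K_d-K_d=(1-d)\Big\{\sum_{n=0}^\infty \varepsilon_n d^n:\varepsilon_n\in\{-1,0,1\}\Big\}.$$ For a set $F\subset\mathbb{R}$, $F/F$ denotes the set of quotients $x/y$ with $x,y\in F$ and $y\ne 0$. Numerically $\delta=0.155124983896014\ldots$. *)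

(* Defs.v *)
From mathcomp Require Import all_boot all_order all_algebra.
From mathcomp Require Import all_classical all_reals all_analysis.

Set Implicit Arguments.
Unset Strict Implicit.
Unset Printing Implicit Defensive.

Import Order.TTheory GRing.Theory Num.Theory.
Import numFieldNormedType.Exports.

Local Open Scope classical_set_scope.
Local Open Scope ring_scope.

Definition cantorK (R : realType) (d : R) : set R :=
  [set (1 - d) * limn (series (fun n => a n * d ^+ n)) |
    a in [set a : nat -> R | forall n, a n = 0 \/ a n = 1]].

Definition diff_set (R : realType) (A : set R) : set R :=
  [set x - y | x in A & y in A].

Definition quot_set (R : realType) (A : set R) : set R :=
  [set x / y | x in A & y in A `\ 0].

Definition cantorF (R : realType) (d : R) : set R := diff_set (cantorK d).

Definition delta_poly {R : realType} : {poly R} :=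
  1 - 7 *: 'X + 3 *: 'X^2 + 4 *: 'X^3 - 2 *: 'X^4 - 'X^5.

(* Main.v *)
Require Import Defs.
From mathcomp Require Import all_boot all_order all_algebra.
From mathcomp Require Import all_classical all_reals all_analysis.
From mathcomp Require Import ring lra.

Set Implicit Arguments.
Unset Strict Implicit.
Unset Printing Implicit Defensive.

Import Order.TTheory GRing.Theory Num.Theory.
Import numFieldNormedType.Exports.

Local Open Scope classical_set_scope.
Local Open Scope ring_scope.

(* A number t is a quotient of F_d as soon as 0 = sum_n (e_n - t f_n) d^n with
   e_n, f_n in {-1, 0, 1} and f_0 = 1.  Taking e_0 = f_0 = 1, it remains to
   expand (t - 1) / d in base d with the digits e - t f.

   Put b = t / (1 - d), the fixed point of z |-> t + d z, and J = [-b, b].  Let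
   A be the least set containing J and closed under all maps
   z |-> (e - t f) + d z.  If each point of J is the image of a point of A, then
   so is each point of A; as A is bounded, iterating gives an expansion of each
   point of A.  The number (t - 1) / d starts with k digits 1 + t and then falls
   into J, provided that w = 1 - t (1 - 2 d) lies in
   [d^(k+1), (1 + 2 t) d^(k+1)].

   Up to sign, the digits 0, t - 1, 1, t alone cover J by images of J, except
   for the gap between t - 1 + d b and 1 - d b.  This gap is empty when
   t (1 + d) >= 2 (1 - d), which can be combined with the condition on w when
   d >= 0.157.  For 0.155 <= d <= 0.157 the gap, which is symmetric about t / 2,
   is covered by images of J under compositions of three or four maps when t lies
   in a small window, and k = 2 fits this window.  Since delta_poly is decreasing
   and positive at 0.155, these cases include every d > delta. *)

(** * Expansions in base [d] with digits [e - t * f], and the covering of J *)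

Section Reach.
Variable R : realFieldType.

Definition trit (x : R) := [\/ x = -1, x = 0 | x = 1].

Lemma trit_opp x : trit x -> trit (- x).
Proof. by rewrite /trit; case=> ->; rewrite ?opprK ?oppr0; [constructor 3|constructor 2|constructor 1]. Qed.

Lemma trit_norm x : trit x -> `|x| <= 1.
Proof. by case=> ->; rewrite ?normrN ?normr1 ?normr0. Qed.

Variables d t : R.

(** This is the set A, with J the interval [|z| <= b]. The value of [b] enters the lemmas below
    through the equation [b = t + d * b]. *)
Inductive reach (b : R) : R -> Prop :=
| reach_core z : `|z| <= b -> reach b z
| reach_step e f z : trit e -> trit f -> reach b z ->
    reach b (e - t * f + d * z).

Lemma reach_opp b z : reach b z -> reach b (- z).
Proof.
elim=> {}z => [zb|f z' te tf _ IH]; first by apply: reach_core; rewrite normrN.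
have -> : - (z - t * f + d * z') = - z - t * (- f) + d * - z' by ring.
by apply: reach_step => //; apply: trit_opp.
Qed.

Definition unfolds b z :=
  exists e f z', [/\ trit e, trit f, reach b z' & z = e - t * f + d * z'].

Lemma unfolds_opp b z : unfolds b z -> unfolds b (- z).
Proof.
move=> [e [f [z' [te tf rz ->]]]]; exists (- e), (- f), (- z').
by split; [exact: trit_opp|exact: trit_opp|exact: reach_opp|ring].
Qed.

Lemma reach_unfolds b :
  (forall z, `|z| <= b -> unfolds b z) -> forall z, reach b z -> unfolds b z.
Proof. by move=> H z [{}z /H//|e f {}z te tf rz]; exists e, f, z. Qed.

Lemma reach_bounded b M z : 0 <= d -> 0 <= t -> b <= M -> 1 + t + d * M <= M ->
  reach b z -> `|z| <= M.
Proof.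
move=> d0 t0 bM hM; elim=> {}z => [/le_trans->//|f z' /trit_norm te /trit_norm tf _ IH].
apply: le_trans hM; apply: (le_trans (ler_normD _ _)); apply: lerD.
  apply: (le_trans (ler_normB _ _)); apply: lerD => //.
  by rewrite normrM (ger0_norm t0) ler_piMr.
by rewrite normrM (ger0_norm d0) ler_wpM2l.
Qed.

(* [M] is the fixed point of [z |-> 1 + t + d z], the largest number with an
   expansion. *)
Lemma reach_below_top b M k x : M = 1 + t + d * M ->
  reach b (M - x) -> reach b (M - d ^+ k * x).
Proof.
move=> hM; elim: k x => [|k IH] x rx; first by rewrite expr0 mul1r.
rewrite exprSr -mulrA; apply: (IH (d * x)).
have -> : M - d * x = 1 - t * (-1) + d * (M - x) by rewrite {1}hM; ring.
by apply: reach_step => //; [constructor 3|constructor 1].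
Qed.

Lemma reach_first b k : 0 < d < 1 / 4 -> 0 < t -> b = t + d * b ->
  d ^+ k.+1 <= 1 - t * (1 - 2 * d) <= (1 + 2 * t) * d ^+ k.+1 ->
  reach b ((t - 1) / d).
Proof.
move=> /andP[d0 d1] t0 hb /andP[w1 w2].
have e0 : 0 < 1 - d by lra.
have dk : 0 < d ^+ k.+1 by rewrite exprn_gt0.
have be : b = t / (1 - d) by apply: (mulIf (lt0r_neq0 e0)); rewrite mulfVK ?lt0r_neq0//; lra.
pose w := 1 - t * (1 - 2 * d).
pose M := (1 + t) / (1 - d).
(* The distance from [(t - 1) / d] to [M] is [w / (d * (1 - d))], and removing a digit [1 + t]
   divides the distance to [M] by [d]. The bounds [h1] and [h2] below are [M - b] and [M + b]. *)
have -> : (t - 1) / d = M - d ^+ k * (w / (d ^+ k.+1 * (1 - d))).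
  rewrite /M /w exprS; field; rewrite ?lt0r_neq0//.
  by rewrite exprn_gt0.
apply: reach_below_top; first by rewrite /M; field; rewrite lt0r_neq0.
apply: reach_core; rewrite ler_norml.
have h1 : 1 / (1 - d) <= w / (d ^+ k.+1 * (1 - d)).
  rewrite invfM mulrA ler_pM2r ?invr_gt0// ler_pdivlMr// mul1r; exact: w1.
have h2 : w / (d ^+ k.+1 * (1 - d)) <= (1 + 2 * t) / (1 - d).
  rewrite invfM mulrA ler_pM2r ?invr_gt0// ler_pdivrMr//; exact: w2.
have hM : M = 1 / (1 - d) + t / (1 - d) by rewrite /M mulrDl.
have h3 : (1 + 2 * t) / (1 - d) = 1 / (1 - d) + 2 * (t / (1 - d)) by rewrite mulrDl mulrA.
by rewrite be; apply/andP; split; lra.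
Qed.

Lemma scaled_core b s v z : 0 < s -> v - s * b <= z <= v + s * b ->
  exists2 j, reach b j & z = v + s * j.
Proof.
move=> s0 /andP[h1 h2]; exists ((z - v) / s); last by rewrite mulrC mulfVK ?lt0r_neq0//; ring.
apply: reach_core; rewrite ler_norml ler_pdivlMr// ler_pdivrMr//.
by apply/andP; split; lra.
Qed.

(* Only the lower half of the gap has to be covered: [z |-> t - z] exchanges the
   digits [t - 1] and [1]. *)
Lemma core_unfolds b : 0 < d -> 0 < t -> b = t + d * b -> t - 1 <= 2 * (d * b) ->
  (forall z, t - 1 + d * b < z -> z < 1 - d * b -> z <= t / 2 ->
     exists2 a, reach b a & z = t - 1 + d * a \/ z = 1 + d * a) ->
  forall z, `|z| <= b -> unfolds b z.
Proof.
move=> d0 t0 hb ht gap.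
have m1 : trit (-1) by constructor 1.
have z0 : trit 0 by constructor 2.
have p1 : trit 1 by constructor 3.
suff pos z : 0 <= z -> z <= b -> unfolds b z.
  move=> z; rewrite ler_norml => /andP[z1 z2]; have [zp|zn] := leP 0 z; first exact: pos.
  by rewrite -[z]opprK; apply: unfolds_opp; apply: pos; lra.
move=> zp zb.
(* The images of J are intervals of radius [d * b] about the digits. By [ht] those about 0 and
   [t - 1] meet, and so do those about 1 and [t]; by [hb] the last one ends at [b]. *)
have [h1|h1] := leP z (d * b).
  have [||j rj ->] := @scaled_core b d 0 z; [by []|by apply/andP; split; lra|].
  by exists 0, 0, j; split => //; ring.
have [h2|h2] := leP z (t - 1 + d * b).
  have [||j rj ->] := @scaled_core b d (t - 1) z; [by []|by apply/andP; split; lra|].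
  by exists (-1), (-1), j; split => //; ring.
have [h3|h3] := leP (t - d * b) z.
  have [||j rj ->] := @scaled_core b d t z; [by []|by apply/andP; split; lra|].
  by exists 0, (-1), j; split => //; ring.
have [h4|h4] := leP (1 - d * b) z.
  have [||j rj ->] := @scaled_core b d 1 z; [by []|by apply/andP; split; lra|].
  by exists 1, 0, j; split => //; ring.
have [h5|h5] := leP z (t / 2).
  have [a ra [->|->]] := gap z h2 h4 h5.
    by exists (-1), (-1), a; split => //; ring.
  by exists 1, 0, a; split => //; ring.
have [|||a ra ha] := gap (t - z); [lra|lra|lra|].
have -> : z = t - (t - z) by ring.
case: ha => ->.
  by exists 1, 0, (- a); split => //; [exact: reach_opp|ring].
by exists (-1), (-1), (- a); split => //; [exact: reach_opp|ring].
Qed.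

(** Since [t = b - d * b], the last hypothesis on [b] says [1 - d * b <= t - 1 + d * b]: the gap is
    empty. *)
Lemma core_unfolds_large b : 0 < d -> 0 < t <= 2 -> b = t + d * b ->
  t - 1 <= 2 * (d * b) -> 2 <= b * (1 + d) ->
  forall z, `|z| <= b -> unfolds b z.
Proof. by move=> d0 /andP[t0 t2] hb h1 h2; apply: core_unfolds => // z g1 g2 _; exfalso; lra. Qed.

(* With p = 1 + t, the lower half of the gap is covered from bottom to top by the
   images of J with leading digits (1, -t, -p, -p), (t - 1, t, t, p) and
   (1, -t, -p).  The second hypothesis on [b] makes the first two images overlap;
   the first one makes the first image meet the image of J under the digit t - 1
   and also makes the last two images overlap; the third hypothesis makes the last
   image reach t / 2. *)
Lemma core_unfolds_small b : 0 < d -> 0 < t -> b = t + d * b ->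
  t - 1 <= 2 * (d * b) ->
  2 - d ^+ 2 - d ^+ 3 <= b * (1 + d) ->
  b * (1 + d - 4 * d ^+ 4) <= 2 - d ^+ 2 - 2 * d ^+ 3 ->
  2 * d * (t + d * (1 + t) - d ^+ 2 * b) <= 2 - t ->
  forall z, `|z| <= b -> unfolds b z.
Proof.
move=> d0 t0 hb ht h1 h2 h3; apply: core_unfolds => // z g1 g2 g3.
have m1 : trit (-1) by constructor 1.
have z0 : trit 0 by constructor 2.
have p1 : trit 1 by constructor 3.
have rp a : reach b a -> reach b (1 + t + d * a).
  by move=> ra; have := reach_step p1 m1 ra; rewrite mulrN1 opprK.
have rq a : reach b a -> reach b (t + d * a).
  by move=> ra; have := reach_step z0 m1 ra; rewrite mulrN1 opprK add0r.
have rpn a : reach b a -> reach b (- (1 + t) + d * a).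
  move=> /(reach_opp)/rp/reach_opp; congr reach; ring.
have rqn a : reach b a -> reach b (- t + d * a).
  move=> /(reach_opp)/rq/reach_opp; congr reach; ring.
(* After this substitution the sums of digits telescope, and the overlap conditions reduce to the
   hypotheses. *)
have te : t = b - d * b by lra.
have [k1|k1] := leP z (1 + d * (- t + d * (- (1 + t) + d * (- (1 + t) + d * b)))).
  have [||j rj ->] := @scaled_core b (d ^+ 4)
    (1 + d * (- t + d * (- (1 + t) + d * (- (1 + t))))) z; first by rewrite exprn_gt0.
    apply/andP; split; rewrite te in g1 k1 *; lra.
  exists (- t + d * (- (1 + t) + d * (- (1 + t) + d * j))); last by right; ring.
  by apply/rqn/rpn/rpn.
have [k2|k2] := leP z (t - 1 + d * (t + d * (t + d * (1 + t + d * b)))).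
  have [||j rj ->] := @scaled_core b (d ^+ 4)
    (t - 1 + d * (t + d * (t + d * (1 + t)))) z; first by rewrite exprn_gt0.
    apply/andP; split; rewrite te in k1 k2 *; lra.
  exists (t + d * (t + d * (1 + t + d * j))); last by left; ring.
  by apply/rq/rq/rp.
have [||j rj ->] := @scaled_core b (d ^+ 3)
    (1 + d * (- t + d * (- (1 + t)))) z; first by rewrite exprn_gt0.
  apply/andP; split; rewrite te in h3 g3 k2 *; lra.
exists (- t + d * (- (1 + t) + d * j)); last by right; ring.
by apply/rqn/rpn.
Qed.

End Reach.

(** * From points of A to digit series and quotients *)

Section Expansion.
Variable R : realType.
Implicit Types (d t b z : R) (e f : nat -> R).

Lemma trit_series_cvg d e : 0 < d < 1 -> (forall n, trit (e n)) ->
  cvgn (series (fun n => e n * d ^+ n)).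
Proof.
move=> /andP[d0 d1] te; apply: normed_cvg.
apply: (@series_le_cvg _ _ (geometric 1 d)) => [n|n|n|].
- exact: normr_ge0.
- by rewrite /= mul1r exprn_ge0// ltW.
- rewrite /= mul1r normrM (ger0_norm (exprn_ge0 n (ltW d0))).
  rewrite -[leRHS]mul1r ler_pM2r ?exprn_gt0//.
  exact: trit_norm.
- by apply: is_cvg_geometric_series; rewrite ger0_norm// ltW.
Qed.

(** A signed digit sequence is the indicator of its digits 1 minus the indicator of its digits -1,
    and both are digit sequences for [cantorK]. *)
Lemma cantorF_trit d e : 0 < d < 1 -> (forall n, trit (e n)) ->
  cantorF d ((1 - d) * limn (series (fun n => e n * d ^+ n))).
Proof.
move=> d01 te.
pose digit c n : R := (e n == c)%:R.
have digitP c n : digit c n = 0 \/ digit c n = 1.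
  by rewrite /digit; case: eqP; [right|left].
have digit_cvg c : cvgn (series (fun n => digit c n * d ^+ n)).
  apply: trit_series_cvg => // n.
  by have [->|->] := digitP c n; [constructor 2|constructor 3].
exists ((1 - d) * limn (series (fun n => digit 1 n * d ^+ n))).
  by exists (digit 1) => // n; exact: digitP.
exists ((1 - d) * limn (series (fun n => digit (-1) n * d ^+ n))).
  by exists (digit (-1)) => // n; exact: digitP.
have -> : (fun n => e n * d ^+ n) =
    (fun n => digit 1 n * d ^+ n) - (fun n => digit (-1) n * d ^+ n); last first.
  by rewrite lim_seriesB// mulrBr.
apply/funext => n; rewrite -[RHS]/(_ * _ - _ * _) -mulrBl; congr (_ * _).
have e1 : (-1 == 1 :> R) = false by apply/negbTE/eqP => h; lra.
have e2 : (1 == -1 :> R) = false by rewrite eq_sym.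
have e3 : (0 == 1 :> R) = false by rewrite eq_sym oner_eq0.
have e4 : (0 == -1 :> R) = false by rewrite eq_sym oppr_eq0 oner_eq0.
by rewrite /digit; case: (te n) => ->; rewrite ?eqxx ?e1 ?e2 ?e3 ?e4 ?mulr1n ?mulr0n; ring.
Qed.

Lemma trit_series_gt0 d e : 0 < d < 1 / 2 -> (forall n, trit (e n)) -> e 0%N = 1 ->
  0 < limn (series (fun n => e n * d ^+ n)).
Proof.
move=> /andP[d0 d1] te e0; have e1 : 0 < 1 - d by lra.
have i0 : 0 < (1 - d)^-1 by rewrite invr_gt0.
have i1 : (1 - d) * (1 - d)^-1 = 1 by rewrite divff// lt0r_neq0.
suff h : 1 - d / (1 - d) <= limn (series (fun n => e n * d ^+ n)).
  apply: lt_le_trans h; rewrite subr_gt0 ltr_pdivrMr//; lra.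
apply: limr_ge; first by apply: trit_series_cvg => //; apply/andP; split; lra.
exists 1%N => //= -[//|n] _.
(* The added term is the part of the geometric tail bound not yet spent; it makes the induction
   close. *)
suff H : 1 - d / (1 - d) + d ^+ n.+1 / (1 - d) <= series (fun n => e n * d ^+ n) n.+1.
  by apply: le_trans H; rewrite lerDl mulr_ge0// ?exprn_ge0// ltW.
elim: n => [|n IH]; rewrite seriesSr.
  by rewrite seriesEnat /= big_nil e0 expr0 expr1; lra.
have /trit_norm := te n.+1; rewrite ler_norml => /andP[en _].
have dn : 0 < d ^+ n.+1 by rewrite exprn_gt0.
have : d ^+ n.+1 / (1 - d) = d ^+ n.+1 + d ^+ n.+2 / (1 - d).
  by rewrite [d ^+ n.+2]exprS; field; rewrite lt0r_neq0.
have : - d ^+ n.+1 <= e n.+1 * d ^+ n.+1 by rewrite -mulN1r ler_pM2r.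
move: IH; lra.
Qed.

Lemma reach_expansion d t b z : 0 < d < 1 -> 0 <= t -> b = t + d * b ->
  (forall x, reach d t b x -> unfolds d t b x) -> reach d t b z ->
  exists e f : nat -> R, [/\ forall n, trit (e n), forall n, trit (f n) &
    series (fun n => (e n - t * f n) * d ^+ n) @ \oo --> z].
Proof.
move=> /andP[d0 d1] t0 hb unf rz.
(* A total choice of digits and remainder; outside A it takes the default [(0, 0, 0)]. The orbit of
   [z] stays in A. *)
have /choice[g gP] : forall x, exists y : R * R * R, reach d t b x ->
    [/\ trit y.1.1, trit y.1.2, reach d t b y.2 &
        x = y.1.1 - t * y.1.2 + d * y.2].
  move=> x; have [/unf[e [f [x' H]]]|nrx] := pselect (reach d t b x).
    by exists (e, f, x').
  by exists (0, 0, 0).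
pose orb n := iter n (fun x => (g x).2) z.
have ro n : reach d t b (orb n) by elim: n => [//|n /gP[]].
exists (fun n => (g (orb n)).1.1), (fun n => (g (orb n)).1.2).
split=> [n|n|]; try by have [] := gP _ (ro n).
have e0 : 0 < 1 - d by lra.
pose M := (1 + t) / (1 - d).
have hM : 1 + t + d * M = M by rewrite /M; field; rewrite lt0r_neq0.
have bM : b <= M by rewrite /M ler_pdivlMr//; lra.
(* The partial sums miss [z] by [d ^+ n] times a remainder in A, which is bounded by [M]. *)
have -> : series (fun n => ((g (orb n)).1.1 - t * (g (orb n)).1.2) * d ^+ n) =
    (fun n => z - d ^+ n * orb n).
  apply/funext; elim=> [|n IH].
    by rewrite seriesEnat /= big_nil expr0 mul1r subrr.
  rewrite seriesSr IH; have [_ _ _ {1}->] := gP _ (ro n).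
  by rewrite -/(orb n.+1) exprS; ring.
rewrite -[X in _ --> X]subr0; apply: cvgB; first exact: cvg_cst.
apply/norm_cvg0P.
apply: (@squeeze_cvgr _ _ _ _ (cst 0) (geometric M d)).
- near=> n; rewrite normr_ge0 /= normrM mulrC (ger0_norm (exprn_ge0 n (ltW d0))).
  rewrite ler_pM2r ?exprn_gt0//.
  by apply: reach_bounded (ro n) => //; rewrite ?hM// ltW.
- exact: cvg_cst.
- by apply: cvg_geometric; rewrite ger0_norm// ltW.
Unshelve. all: by end_near. Qed.

Lemma series_cons d z (c : nat -> R) (c0 : R) :
  series (fun n => c n * d ^+ n) @ \oo --> z ->
  series (fun n => (if n is m.+1 then c m else c0) * d ^+ n) @ \oo -->
    c0 + d * z.
Proof.
move=> cz; rewrite -cvg_shiftS /=.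
have -> : (fun n => series (fun n => (if n is m.+1 then c m else c0) * d ^+ n) n.+1) =
    (fun n => c0 + d * series (fun n => c n * d ^+ n) n).
  apply/funext; elim=> [|n IH].
    by rewrite seriesSr !seriesEnat /= !big_nil expr0; ring.
  by rewrite seriesSr IH [in RHS]seriesSr exprS; ring.
by apply: cvgD; [exact: cvg_cst|apply: cvgM => //; exact: cvg_cst].
Qed.

(** Putting the digit [1 - t] before an expansion of [(t - 1) / d] expands 0. Separating [e] from
    [f] gives [X = t * Y], and [Y] is positive because its leading digit is 1. *)
Lemma quot_set_reach d t b : 0 < d < 1 / 2 -> 0 <= t -> b = t + d * b ->
  (forall x, `|x| <= b -> unfolds d t b x) -> reach d t b ((t - 1) / d) ->
  quot_set (cantorF d) t.
Proof.
move=> /andP[d0 d1] t0 hb core rz.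
have d01 : 0 < d < 1 by apply/andP; split; lra.
have dh : 0 < d < 1 / 2 by apply/andP; split; lra.
have [e [f [te tf ecvg]]] := reach_expansion d01 t0 hb (reach_unfolds core) rz.
pose e' n := if n is m.+1 then e m else 1.
pose f' n := if n is m.+1 then f m else 1.
have te' n : trit (e' n) by case: n => [|n]; [constructor 3|exact: te].
have tf' n : trit (f' n) by case: n => [|n]; [constructor 3|exact: tf].
set X := limn (series (fun n => e' n * d ^+ n)).
set Y := limn (series (fun n => f' n * d ^+ n)).
have Y0 : 0 < Y by exact: trit_series_gt0.
have XY : X - t * Y = 0.
  have h := @series_cons d _ _ (1 - t) ecvg.
  rewrite mulrCA divff ?lt0r_neq0// mulr1 in h.
  have ec := trit_series_cvg d01 te'; have fc := trit_series_cvg d01 tf'.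
  have -> : X - t * Y =
      limn (series ((fun n => e' n * d ^+ n) - t *: (fun n => f' n * d ^+ n))).
    by rewrite lim_seriesB; [rewrite lim_seriesZ| |exact: is_cvg_seriesZ].
  have -> : (fun n => e' n * d ^+ n) - t *: (fun n => f' n * d ^+ n) =
      (fun n => (if n is m.+1 then e m - t * f m else 1 - t) * d ^+ n).
    apply/funext => -[|n]; rewrite -[LHS]/(_ - t * _) /=; ring.
  by rewrite (cvg_lim (@Rhausdorff R) h); ring.
exists ((1 - d) * X); first exact: cantorF_trit.
exists ((1 - d) * Y).
  split; first exact: cantorF_trit.
  by move=> /eqP; rewrite mulf_eq0 (gt_eqF Y0) orbF => /eqP; lra.
have -> : X = t * Y by lra.
by field; rewrite (gt_eqF Y0) /=; apply/eqP; lra.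
Qed.

End Expansion.

(** * Windows of quotients for each range of [d] *)

Section Quotients.
Variable R : realType.
Implicit Types d t x y : R.

Lemma quot_set_large k d t : 0 < d < 1 / 4 -> 1 <= t -> 2 * (1 - d) <= t * (1 + d) ->
  d ^+ k.+1 <= 1 - t * (1 - 2 * d) <= (1 + 2 * t) * d ^+ k.+1 ->
  quot_set (cantorF d) t.
Proof.
move=> /andP[d0 d1] t1 ht hw; have e0 : 0 < 1 - d by lra.
have w0 : 0 < 1 - t * (1 - 2 * d).
  by have /andP[/(lt_le_trans _)-> //] := hw; rewrite exprn_gt0.
pose b := t / (1 - d).
have be : b * (1 - d) = t by rewrite /b mulfVK// lt0r_neq0.
have hb : b = t + d * b by lra.
have t2 : t <= 2 by nra.
apply: (@quot_set_reach _ d t b) => //; [lra|lra| |].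
- apply: core_unfolds_large => //; [lra| |].
  (* The claim becomes [t * (1 - 3 * d) <= 1 - d], which follows from [t * (1 - 2 * d) < 1] and
     [1 <= t]. *)
  + rewrite -(ler_pM2r e0) (_ : 2 * (d * b) * (1 - d) = 2 * d * t); last by rewrite -be; ring.
    nra.
  + by rewrite -(ler_pM2r e0) mulrAC be.
- apply: (@reach_first _ d t b k) => //; lra.
Qed.

Lemma pow_bounds d : 31 / 200 <= d -> d <= 157 / 1000 ->
  24 / 1000 <= d ^+ 2 /\ d ^+ 2 <= 1 / 40 /\
  11 / 3000 <= d ^+ 3 /\ d ^+ 3 <= 1 / 250 /\ d ^+ 4 <= 1 / 1600.
Proof.
move=> d1 d2; have d0 : 0 <= d by lra.
have e0 : 0 <= d - 31 / 200 by lra.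
have g0 : 0 <= 157 / 1000 - d by lra.
have s0 := sqr_ge0 (d - 31 / 200).
have s1 := mulr_ge0 d0 s0.
have c0 := mulr_ge0 e0 g0.
have c1 := mulr_ge0 d0 c0.
have c2 := mulr_ge0 d0 c1.
by clear e0 g0; repeat split; lra.
Qed.

(* The bounds on [t] below delimit the window of quotients in which
   [core_unfolds_small] applies; they are its hypotheses on [b] times [1 - d]. *)
Lemma window_bounds d t : 31 / 200 <= d <= 157 / 1000 ->
  (1 - d) * (2 - d ^+ 2 - d ^+ 3) <= t * (1 + d) ->
  t * (1 + d - 4 * d ^+ 4) <= (1 - d) * (2 - d ^+ 2 - 2 * d ^+ 3) ->
  14 / 10 <= t <= 289 / 200.
Proof.
move=> /andP[d1 d2] h1 h2.
have [q1 [q2 [c1 [c2 f2]]]] := pow_bounds d1 d2.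
apply/andP; split.
  have l : 843 / 1000 * (1971 / 1000) <= (1 - d) * (2 - d ^+ 2 - d ^+ 3).
    by clear h1 h2; apply: ler_pM; lra.
  have {h1}l := le_trans l h1; clear h2.
  rewrite leNgt; apply/negP => tl.
  have d0 : 0 < 1 + d by clear -d1; lra.
  have : t * (1 + d) < 14 / 10 * (1 + d) by rewrite ltr_pM2r.
  clear -l d2; lra.
have l : (1 - d) * (2 - d ^+ 2 - 2 * d ^+ 3) <= 845 / 1000 * (197 / 100).
  by clear h1 h2; apply: ler_pM; lra.
have {h2}l := le_trans h2 l; clear h1.
rewrite leNgt; apply/negP => tl.
have D0 : 0 < 1 + d - 4 * d ^+ 4 by clear -d1 f2; lra.
have : 289 / 200 * (1 + d - 4 * d ^+ 4) < t * (1 + d - 4 * d ^+ 4) by rewrite ltr_pM2r.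
clear -l d1 f2; lra.
Qed.

(** At the upper end of the window this is the third hypothesis of [core_unfolds_small], with [b]
    replaced by its lower bound [t]. *)
Lemma window_gap d : 31 / 200 <= d <= 157 / 1000 ->
  (1 - d) * (2 - d ^+ 2 - 2 * d ^+ 3) * (1 + 2 * d + 2 * d ^+ 2 - 2 * d ^+ 3) <=
  (2 - 2 * d ^+ 2) * (1 + d - 4 * d ^+ 4).
Proof.
move=> /andP[d1 d2]; have [q1 [q2 [c1 [c2 f2]]]] := pow_bounds d1 d2.
(* The right side minus the left side is this product plus [2 * d ^+ 6 + 4 * d ^+ 7]. *)
have : 0 <= d ^+ 2 * (-1 + 9 * d - 10 * d ^+ 2 - 4 * d ^+ 3) by apply: mulr_ge0; lra.
have : 0 <= d ^+ 6 by rewrite exprn_ge0; lra.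
have : 0 <= d ^+ 7 by rewrite exprn_ge0; lra.
clear; lra.
Qed.

(** This is the lower bound on w for k = 2, at the upper end of the window. The margin at 31/200 is
    below 1/1000, too small for [pow_bounds]; powers of [d] are bounded by chords instead. *)
Lemma window_lower d : 31 / 200 <= d <= 157 / 1000 ->
  (1 - d) * (2 - d ^+ 2 - 2 * d ^+ 3) * (1 - 2 * d) <=
  (1 - d ^+ 3) * (1 + d - 4 * d ^+ 4).
Proof.
move=> /andP[d1 d2].
have chord n : d ^+ n.+2 <= (31 / 200 + 157 / 1000) * d ^+ n.+1
                             - 31 / 200 * (157 / 1000) * d ^+ n.
  have : 0 <= d ^+ n * ((d - 31 / 200) * (157 / 1000 - d)).
    by apply: mulr_ge0; [rewrite exprn_ge0|apply: mulr_ge0]; lra.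
  by rewrite !exprS; clear; lra.
have := (chord 0, chord 1, chord 2); rewrite expr0 expr1 => -[[k0 k1] k2].
have : 0 <= d ^+ 5 by rewrite exprn_ge0; lra.
have : 0 <= d ^+ 7 by rewrite exprn_ge0; lra.
clear chord; lra.
Qed.

(** This is the upper bound on w for k = 2, at the lower end of the window. It is tightest at
    157/1000, hence the tangents there. *)
Lemma window_upper d : 31 / 200 <= d <= 157 / 1000 ->
  (1 - d ^+ 3) * (1 + d) <=
  (1 - d) * (2 - d ^+ 2 - d ^+ 3) * (1 - 2 * d + 2 * d ^+ 3).
Proof.
move=> /andP[d1 d2].
have tangent n : 157 / 500 * d ^+ n.+1 - (157 / 1000) ^+ 2 * d ^+ n <= d ^+ n.+2.
  have : 0 <= d ^+ n * (d - 157 / 1000) ^+ 2.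
    by apply: mulr_ge0; [rewrite exprn_ge0; lra|rewrite sqr_ge0].
  by rewrite !exprS; clear; lra.
have [q1 [q2 [c1 [c2 f2]]]] := pow_bounds d1 d2.
have := (tangent 0, tangent 1); rewrite expr0 expr1 => -[k0 k1].
have : d ^+ 5 <= 157 / 1000 * (1 / 1600).
  by rewrite exprS; apply: ler_pM; rewrite ?exprn_ge0; lra.
have : 0 <= d ^+ 7 by rewrite exprn_ge0; lra.
clear tangent; lra.
Qed.

Lemma quot_set_small d t : 31 / 200 <= d <= 157 / 1000 ->
  (1 - d) * (2 - d ^+ 2 - d ^+ 3) <= t * (1 + d) ->
  t * (1 + d - 4 * d ^+ 4) <= (1 - d) * (2 - d ^+ 2 - 2 * d ^+ 3) ->
  quot_set (cantorF d) t.
Proof.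
move=> hd h1 h2.
have /andP[t1 t2] := window_bounds hd h1 h2.
have := (window_gap hd, window_lower hd, window_upper hd) => -[[p1 p2] p3].
move: hd => /andP[d1 d2]; have e0 : 0 < 1 - d by clear -d2; lra.
have d0 : 0 < d by clear -d1; lra.
have [q1 [q2 [c1 [c2 f2]]]] := pow_bounds d1 d2.
have D0 : 0 < 1 + d - 4 * d ^+ 4 by clear -d1 f2; lra.
(* Upper bounds on multiples of [t] are checked at the upper end of the window, and lower bounds, by
   [tge], at the lower end. *)
have tle x y : 0 <= y -> (1 - d) * (2 - d ^+ 2 - 2 * d ^+ 3) * y <= x * (1 + d - 4 * d ^+ 4) ->
    t * y <= x.
  move=> y0 hx; rewrite -(ler_pM2r D0); apply: le_trans hx.
  by rewrite (mulrAC t); apply: ler_wpM2r.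
have tge x y : 0 <= y -> x * (1 + d) <= (1 - d) * (2 - d ^+ 2 - d ^+ 3) * y -> x <= t * y.
  move=> y0 hx; rewrite -(@ler_pM2r _ (1 + d)); last by clear -d0; lra.
  by apply: (le_trans hx); rewrite (mulrAC t); apply: ler_wpM2r.
pose b := t / (1 - d).
have be : b * (1 - d) = t by rewrite /b mulfVK// lt0r_neq0.
have hb : b = t + d * b by clear -be; lra.
have b1 : 165 / 100 <= b by rewrite ler_pdivlMr//; clear -t1 d1; lra.
have db : 31 / 200 * (165 / 100) <= d * b by apply: ler_pM; clear -d1 b1; lra.
have b0 : t <= b by clear -hb db; lra.
clearbody b.
apply: (@quot_set_reach _ d t b); [| |exact: hb| |].
- by clear -d1 d2; apply/andP; split; lra.
- by clear -t1; lra.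
- apply: core_unfolds_small; [exact: d0| |exact: hb| | | |].
  + by clear -t1; lra.
  + by clear -t2 db; lra.
  + by rewrite -(ler_pM2r e0); clear -h1 be; rewrite mulrAC be; lra.
  + by rewrite -(ler_pM2r e0); clear -h2 be; rewrite mulrAC be; lra.
  + have {}p1 := tle _ _ _ p1.
    have : d ^+ 3 * t <= d ^+ 3 * b by rewrite ler_pM2l ?exprn_gt0.
    have : t * (1 + 2 * d + 2 * d ^+ 2 - 2 * d ^+ 3) <= 2 - 2 * d ^+ 2.
      by apply: p1; clear -d0 q1 c2; lra.
    clear; lra.
- apply: (@reach_first _ d t b 2); [| |exact: hb|].
  + by clear -d1 d2; apply/andP; split; lra.
  + by clear -t1; lra.
  + apply/andP; split.
      have : t * (1 - 2 * d) <= 1 - d ^+ 3 by apply: tle p2; clear -d2; lra.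
      clear; lra.
    have : 1 - d ^+ 3 <= t * (1 - 2 * d + 2 * d ^+ 3).
      by apply: tge p3; clear -d2 c1; lra.
    clear; lra.
Qed.

Lemma quot_set_itv_small d : 31 / 200 <= d <= 157 / 1000 ->
  exists a b : R, a < b /\ `[a, b] `<=` quot_set (cantorF d).
Proof.
move=> hd; have := hd => /andP[d1 d2].
have [q1 [q2 [c1 [c2 f2]]]] := pow_bounds d1 d2.
have A0 : 0 < 1 + d by clear -d1; lra.
have B0 : 0 < 1 + d - 4 * d ^+ 4 by clear -d1 f2; lra.
exists ((1 - d) * (2 - d ^+ 2 - d ^+ 3) / (1 + d)).
exists ((1 - d) * (2 - d ^+ 2 - 2 * d ^+ 3) / (1 + d - 4 * d ^+ 4)); split.
  rewrite ltr_pdivrMr// mulrAC ltr_pdivlMr// -!mulrA ltr_pM2l; last by clear -d2; lra.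
  have d3 : 0 < d ^+ 3 by clear -c1; lra.
  have e0 : 0 <= d - 31 / 200 by clear -d1; lra.
  have u0 : 0 <= 2 - d ^+ 2 - d ^+ 3 - 197 / 100 by clear -q2 c2; lra.
  (* This is the difference of the two sides after cross-multiplying and cancelling [1 - d]. *)
  have h : 0 < d ^+ 3 * (4 * d * (2 - d ^+ 2 - d ^+ 3) - (1 + d)).
    rewrite pmulr_rgt0//; have := mulr_ge0 e0 u0; clear -d1 d2 q2 c2; lra.
  clear -h; lra.
by move=> t; rewrite /= in_itv /= ler_pdivrMr// ler_pdivlMr// => /andP[]; exact: quot_set_small.
Qed.

Lemma quot_set_itv_large d : 157 / 1000 <= d -> d < 1 / 4 ->
  exists a b : R, a < b /\ `[a, b] `<=` quot_set (cantorF d).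
Proof.
move=> d1 d2; have d0 : 0 < d by clear -d1; lra.
have C0 : 0 < 1 - 2 * d by clear -d2; lra.
have e0 : 0 < d ^+ 5 by rewrite exprn_gt0.
have pow5 c : d * d <= c -> d ^+ 5 <= d * (c * c).
  move=> h; rewrite exprS (exprM d 2 2) !expr2 ler_pM2l//.
  by apply: ler_pM => //; rewrite mulr_ge0// ltW.
have e1 : d ^+ 5 <= d * (1 / 16 * (1 / 16)) by apply: pow5; clear -d0 d2; nra.
(* This is the empty-gap condition at the left end of the interval chosen below. Without [d ^+ 5] it
   reads [4 * d ^+ 2 - 7 * d + 1 <= 0], true only from about 0.15693 on; the small margin at
   157/1000 calls for a power as high as k = 4 gives. *)
have e2 : 2 * (1 - d) * (1 - 2 * d) <= (1 - 2 * d ^+ 5) * (1 + d).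
  have k1 : 0 <= d - 157 / 1000 by clear -d1; lra.
  have k2 : 0 <= 1 / 4 - d by clear -d2; lra.
  have k := mulr_ge0 k1 k2.
  have [h|h] := leP d (17 / 100).
    have e3 : d ^+ 5 <= d * (1 / 34 * (1 / 34)) by apply: pow5; clear -d0 h; nra.
    have : d ^+ 5 * (1 + d) <= d * (1 / 34 * (1 / 34)) * (117 / 100).
      by apply: ler_pM => //; clear -d0 h e0; lra.
    clear -k d1; lra.
  have : d ^+ 5 * (1 + d) <= d * (1 / 16 * (1 / 16)) * (5 / 4).
    by apply: ler_pM => //; clear -d0 d2 e0; lra.
  clear -k h; lra.
(* These ends keep w between [d ^+ 5] and [2 * d ^+ 5], which is at most [(1 + 2 * t) * d ^+ 5] as
   [1 <= t]. *)
exists ((1 - 2 * d ^+ 5) / (1 - 2 * d)), ((1 - d ^+ 5) / (1 - 2 * d)); split.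
  by rewrite ltr_pM2r ?invr_gt0//; clear -e0; lra.
move=> t; rewrite /= in_itv /= ler_pdivrMr// ler_pdivlMr// => /andP[h1 h2].
have t1 : 1 <= t.
  rewrite leNgt; apply/negP => tl.
  have : t * (1 - 2 * d) < 1 * (1 - 2 * d) by rewrite ltr_pM2r.
  clear -h1 e1 d0; lra.
apply: (@quot_set_large 4) => //; first by rewrite d0 d2.
  rewrite -(ler_pM2r C0) (mulrAC t); apply: (le_trans e2).
  by apply: ler_wpM2r => //; clear -d0; lra.
have : 0 <= (t - 1) * d ^+ 5 by rewrite mulr_ge0 ?subr_ge0// ltW.
clear -h1 h2; lra.
Qed.

(** Take k = 1: the gap closes at [t = 10 / 7], and w equals 1/36 at [t = 35 / 24]. *)
Lemma quot_set_itv_sixth : `[10 / 7, 35 / 24] `<=` quot_set (cantorF (1 / 6 : R)).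
Proof.
move=> t; rewrite /= in_itv /= => /andP[h1 h2].
by apply: (@quot_set_large 1); rewrite ?expr2; lra.
Qed.

(** * The zero of [delta_poly] and the case split at 157/1000 *)

Lemma delta_polyE x : (delta_poly : {poly R}).[x] =
  1 - 7 * x + 3 * x ^+ 2 + 4 * x ^+ 3 - 2 * x ^+ 4 - x ^+ 5.
Proof. by rewrite /delta_poly !hornerE. Qed.

Lemma delta_poly_decr x y : 0 <= x -> x < y -> y <= 1 / 6 ->
  (delta_poly : {poly R}).[y] < (delta_poly : {poly R}).[x].
Proof.
move=> x0 xy y6; rewrite !delta_polyE.
have y0 : 0 <= y by apply: le_trans x0 (ltW xy).
have h2 : x ^+ 2 + x * y + y ^+ 2 <= 1 / 4 by nra.
have h4 : 0 <= 2 * (x ^+ 3 + x ^+ 2 * y + x * y ^+ 2 + y ^+ 3) +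
    (x ^+ 4 + x ^+ 3 * y + x ^+ 2 * y ^+ 2 + x * y ^+ 3 + y ^+ 4).
  by rewrite !(addr_ge0, mulr_ge0, exprn_ge0).
(* This product is the value at [x] minus the value at [y]. *)
have : 0 < (y - x) * (7 - 3 * (x + y) - 4 * (x ^+ 2 + x * y + y ^+ 2) +
   (2 * (x ^+ 3 + x ^+ 2 * y + x * y ^+ 2 + y ^+ 3) +
    (x ^+ 4 + x ^+ 3 * y + x ^+ 2 * y ^+ 2 + x * y ^+ 3 + y ^+ 4))).
  by rewrite mulr_gt0 ?subr_gt0//; move: h2 h4; lra.
clear; lra.
Qed.

End Quotients.

Theorem theorem1p1 (R : realType) :
  (exists! delta : R, 1 / 9 < delta < 1 / 6 /\ root delta_poly delta) /\
  (forall delta : R, 1 / 9 < delta < 1 / 6 -> root delta_poly delta ->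
     forall d : R, delta < d < 1 / 4 ->
       exists a b : R, a < b /\ `[a, b] `<=` quot_set (cantorF d)) /\
  `[10 / 7, 35 / 24] `<=` quot_set (cantorF (1 / 6 : R)).
Proof.
split; [|split; last exact: quot_set_itv_sixth].
- have P9 : 0 < (delta_poly : {poly R}).[1 / 9] by rewrite delta_polyE; lra.
  have P6 : (delta_poly : {poly R}).[1 / 6] < 0 by rewrite delta_polyE; lra.
  (* The intermediate value theorem is stated for a passage from nonpositive to nonnegative values,
     hence the opposite polynomial. *)
  have [||x /andP[x9 x6] rx] := @poly_ivt R (- delta_poly) (1 / 9) (1 / 6).
  + by lra.
  + by rewrite !hornerN oppr_le0 oppr_ge0 !ltW.
  rewrite rootN in rx; have {}rx : root delta_poly x by [].
  have x9' : 1 / 9 < x.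
    rewrite lt_neqAle x9 andbT; apply: contraTneq P9 => ->; rewrite (rootP rx) ltxx //.
  have x6' : x < 1 / 6.
    rewrite lt_neqAle x6 andbT; apply: contraTneq P6 => <-; rewrite (rootP rx) ltxx //.
  exists x; split; first by rewrite x9' x6'.
  move=> y [/andP[y9 y6] ry]; apply/eqP; rewrite eq_le !leNgt.
  apply/andP; split; apply/negP => h.
  + have : (delta_poly : {poly R}).[x] < (delta_poly : {poly R}).[y].
      by apply: (delta_poly_decr _ h (ltW x6')); clear -y9; lra.
    by rewrite (rootP rx) (rootP ry) ltxx.
  + have : (delta_poly : {poly R}).[y] < (delta_poly : {poly R}).[x].
      by apply: (delta_poly_decr _ h (ltW y6)); clear -x9; lra.
    by rewrite (rootP rx) (rootP ry) ltxx.
- move=> delta /andP[d9 d6] rd d /andP[dd d4].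
  have hd : 31 / 200 < delta.
    rewrite ltNge; apply/negP => h.
    have P0 : 0 < (delta_poly : {poly R}).[31 / 200] by rewrite delta_polyE; lra.
    move: h; rewrite le_eqVlt => /orP[/eqP h|h].
      by move: P0; rewrite -h (rootP rd) ltxx.
    have : (delta_poly : {poly R}).[31 / 200] < (delta_poly : {poly R}).[delta].
      by apply: (delta_poly_decr _ h); [clear -d9; lra|clear; lra].
    by rewrite (rootP rd) ltNge ltW.
  have [h|h] := leP d (157 / 1000).
    by apply: quot_set_itv_small; rewrite h (ltW (lt_trans hd dd)).
  by apply: quot_set_itv_large => //; exact: ltW.
Qed.
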